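(* Let $(R,\mathfrak m)$ be a noetherian, local, complete ring, and assume that the Cohen-Macaulayfication $B$ of $R$ in the sense of Goto exists. Then $B$, regarded as an $R$-module containing $R$ as a submodule, is a Cohen-Macaulayfication of the $R$-module $R$.
   Context: All rings are commutative; ''complete'' means $\mathfrak m$-adically complete. $H^i_{\mathfrak m}$ denotes local cohomology with support in $\mathfrak m$. Cohen-Macaulayfication in the sense of Goto: let $(A,\mathfrak m)$ be a noetherian local ring of dimension $d\geq 2$ with total quotient ring $Q(A)$. A Cohen-Macaulayfication of $A$ in the sense of Goto is a Cohen-Macaulay ring $B$ with $A\subseteq B\subseteq Q(A)$ such that $B$ is finitely generated as an $A$-module, $\dim(B_{\mathfrak n})=d$ for every maximal ideal $\mathfrak n$ of $B$, and $\mathfrak m\cdot B\subseteq A$. (Such $B$ is uniquely determined if it exists.) Cohen-Macaulayfication of a module: let $M$ be a finitely generated $R$-module and $\tilde M$ a finitely generated $R$-module containing $M$ as a submodule. $\tilde M$ is a Cohen-Macaulayfication of $M$ if (i) $\tilde M$ is a Cohen-Macaulay $R$-module; (ii) $\dim(\tilde M)=\dim(M)$; (iii) $H^{\dim(M)-1}_{\mathfrak m}(\tilde M/M)=H^{\dim(M)}_{\mathfrak m}(\tilde M/M)=0$. *)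

(* Defs.v *)
From HB Require Import structures.
From mathcomp Require Import all_boot all_order all_algebra ring.
From mathcomp Require Import generic_quotient ring_quotient.
From mathcomp Require Import boolp classical_sets.

Set Implicit Arguments.
Unset Strict Implicit.
Unset Printing Implicit Defensive.

Import GRing.Theory.
Local Open Scope classical_set_scope.
Local Open Scope ring_scope.
Local Open Scope quotient_scope.

Section Modules.
Variables (R : comPzRingType) (M : lmodType R).
Implicit Types N : set M.

Definition is_submodule N :=
  [/\ N 0, forall x y, N x -> N y -> N (x + y)
    & forall (a : R) x, N x -> N (a *: x)].

Definition span (A : set M) : set M := smallest is_submodule A.

Definition fg_submodule N := exists s : seq M, span [set` s] = N.

Definition fg_module := fg_submodule setT.

Definition annihilator : set R := [set a | forall v : M, a *: v = 0].

Definition scale_submodule (I : set R) : set M :=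
  span [set a *: v | a in I & v in [set: M]].

End Modules.

Arguments fg_module {R} M.
Arguments annihilator {R} M.
Arguments scale_submodule {R} M I.

Section Ideals.
Variable R : comPzRingType.
Implicit Types I J P m : set R.

Definition is_ideal I := is_submodule (I : set R^o).

Definition prime_ideal P :=
  [/\ is_ideal P, ~ P 1 & forall x y, P (x * y) -> P x \/ P y].

Definition maximal_ideal m :=
  [/\ is_ideal m, ~ m 1
    & forall J, is_ideal J -> ~ J 1 -> m `<=` J -> J = m].

Definition local_ring m := maximal_ideal m /\ forall n, maximal_ideal n -> n = m.

Definition noetherian := forall I, is_ideal I -> fg_submodule (I : set R^o).

Fixpoint ideal_pow I (n : nat) : set R :=
  if n is k.+1 then
    span ([set a * b | a in I & b in ideal_pow I k] : set R^o)
  else setT.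

(* The canonical map from R to the inverse limit of the R/m^n is bijective. *)
Definition adically_complete m :=
  forall u : nat -> R, (forall n, ideal_pow m n (u n.+1 - u n)) ->
  exists! l : R, forall n, ideal_pow m n (l - u n).

Definition prime_chain I (k : nat) := exists P : nat -> set R,
  (forall i, (i <= k)%N -> prime_ideal (P i) /\ I `<=` P i) /\
  (forall i, (i < k)%N -> P i `<` P i.+1).

(* dim (R/I) = d; there is no such d when I = R. *)
Definition has_quotient_dim I (d : nat) :=
  prime_chain I d /\ forall k, prime_chain I k -> (k <= d)%N.

Definition has_ring_dim (d : nat) := has_quotient_dim [set 0] d.

Definition has_module_dim (M : lmodType R) (d : nat) :=
  has_quotient_dim (annihilator M) d.

End Ideals.

Arguments noetherian R : clear implicits.
Arguments has_ring_dim R d : clear implicits.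
Arguments has_module_dim {R} M d.

Section CohenMacaulay.
Variable R : comPzRingType.

Definition regular_sequence (M : lmodType R) (x : seq R) :=
  (forall i, (i < size x)%N -> forall v : M,
      scale_submodule M [set` take i x] (nth 0 x i *: v) ->
      scale_submodule M [set` take i x] v) /\
  scale_submodule M [set` x] <> setT.

Definition has_depth (m : set R) (M : lmodType R) (d : nat) :=
  let regular_in_m x := [set` x] `<=` m /\ regular_sequence M x in
  (exists2 x, regular_in_m x & size x = d) /\
  (forall x, regular_in_m x -> (size x <= d)%N).

Definition cm_module (m : set R) (M : lmodType R) :=
  fg_module M /\ exists d, has_module_dim M d /\ has_depth m M d.

Definition cm_local_ring :=
  noetherian R /\ exists m : set R, local_ring m /\ cm_module m R^o.

End CohenMacaulay.

Arguments cm_local_ring R : clear implicits.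

Section Localization.
Variables (R : comNzRingType) (S : set R).

Definition mul_closed (T : set R) :=
  T 1 /\ forall x y, T x -> T y -> T (x * y).

(* Inverting S amounts to inverting the multiplicative set it generates, which
   is S itself when S is multiplicative. *)
Definition denominators : set R := smallest mul_closed S.

Lemma denominators1 : denominators 1.
Proof. by move=> T [[T1 _] _]. Qed.

Lemma denominatorsM x y :
  denominators x -> denominators y -> denominators (x * y).
Proof.
by move=> dx dy T TS; have [[_ TM] _] := TS; apply: TM; [apply: dx|apply: dy].
Qed.

Record fraction := Fraction { ratio :> R * R; _ : `[< denominators ratio.2 >] }.

HB.instance Definition _ := [isSub for ratio].
HB.instance Definition _ := [Choice of fraction by <:].

Lemma denomP (x : fraction) : denominators x.2.
Proof. by case: x => r /= /asboolP. Qed.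

Definition mkfrac (a s : R) (hs : denominators s) : fraction :=
  @Fraction (a, s) (introT (asboolP _) hs).

Definition equivf (x y : fraction) :=
  `[< exists2 t, denominators t & t * (x.1 * y.2 - y.1 * x.2) = 0 >].

Lemma equivf_refl : reflexive equivf.
Proof.
move=> x; apply/asboolP; exists 1; first exact: denominators1.
by rewrite subrr mulr0.
Qed.

Lemma equivf_sym : symmetric equivf.
Proof.
suff imp x y : equivf x y -> equivf y x.
  by move=> x y; apply/idP/idP; apply: imp.
move=> /asboolP[t dt e]; apply/asboolP; exists t => //.
by rewrite -opprB mulrN e oppr0.
Qed.

Lemma equivf_trans : transitive equivf.
Proof.
move=> y x z /asboolP[t dt e] /asboolP[u du f]; apply/asboolP.
exists (t * u * y.2); first by do 2?apply: denominatorsM => //; apply: denomP.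
have -> : t * u * y.2 * (x.1 * z.2 - z.1 * x.2) =
    u * z.2 * (t * (x.1 * y.2 - y.1 * x.2)) +
    t * x.2 * (u * (y.1 * z.2 - z.1 * y.2)) by ring.
by rewrite e f !mulr0 addr0.
Qed.

Canonical equivf_equiv := EquivRel equivf equivf_refl equivf_sym equivf_trans.

Definition localization := {eq_quot equivf}.

HB.instance Definition _ : EqQuotient _ equivf localization :=
  EqQuotient.on localization.
HB.instance Definition _ := Choice.on localization.

Definition addf (x y : fraction) : fraction :=
  mkfrac (x.1 * y.2 + y.1 * x.2) (denominatorsM (denomP x) (denomP y)).
Definition oppf (x : fraction) : fraction := mkfrac (- x.1) (denomP x).
Definition mulf (x y : fraction) : fraction :=
  mkfrac (x.1 * y.1) (denominatorsM (denomP x) (denomP y)).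

Definition loc_frac (a s : R) (hs : denominators s) : localization :=
  \pi_localization (mkfrac a hs).
Definition to_loc (a : R) : localization := loc_frac a denominators1.

Lemma equivf_repr x : equivf x (repr (\pi_localization x)).
Proof. by apply/eqmodP; rewrite reprK. Qed.

Definition loc_add := lift_op2 localization addf.
Definition loc_opp := lift_op1 localization oppf.
Definition loc_mul := lift_op2 localization mulf.

Lemma pi_addf : {morph \pi : x y / addf x y >-> loc_add x y}.
Proof.
move=> x y; unlock loc_add; apply/eqmodP.
have /asboolP[t dt e] := equivf_repr x; have /asboolP[u du f] := equivf_repr y.
set x' := repr _ in e *; set y' := repr _ in f *.
apply/asboolP; exists (t * u); first exact: denominatorsM.
have -> : t * u * ((addf x y).1 * (addf x' y').2 -
                   (addf x' y').1 * (addf x y).2) =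
    u * y.2 * y'.2 * (t * (x.1 * x'.2 - x'.1 * x.2)) +
    t * x.2 * x'.2 * (u * (y.1 * y'.2 - y'.1 * y.2)) by rewrite /=; ring.
by rewrite e f !mulr0 addr0.
Qed.
Canonical pi_addf_morph := PiMorph2 pi_addf.

Lemma pi_oppf : {morph \pi : x / oppf x >-> loc_opp x}.
Proof.
move=> x; unlock loc_opp; apply/eqmodP.
have /asboolP[t dt e] := equivf_repr x; set x' := repr _ in e *.
apply/asboolP; exists t => //.
have -> : t * ((oppf x).1 * (oppf x').2 - (oppf x').1 * (oppf x).2) =
    - (t * (x.1 * x'.2 - x'.1 * x.2)) by rewrite /=; ring.
by rewrite e oppr0.
Qed.
Canonical pi_oppf_morph := PiMorph1 pi_oppf.

Lemma pi_mulf : {morph \pi : x y / mulf x y >-> loc_mul x y}.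
Proof.
move=> x y; unlock loc_mul; apply/eqmodP.
have /asboolP[t dt e] := equivf_repr x; have /asboolP[u du f] := equivf_repr y.
set x' := repr _ in e *; set y' := repr _ in f *.
apply/asboolP; exists (t * u); first exact: denominatorsM.
have -> : t * u * ((mulf x y).1 * (mulf x' y').2 -
                   (mulf x' y').1 * (mulf x y).2) =
    u * y.1 * y'.2 * (t * (x.1 * x'.2 - x'.1 * x.2)) +
    t * x.2 * x'.1 * (u * (y.1 * y'.2 - y'.1 * y.2)) by rewrite /=; ring.
by rewrite e f !mulr0 addr0.
Qed.
Canonical pi_mulf_morph := PiMorph2 pi_mulf.

Lemma pi_eqf (x y : fraction) : x.1 * y.2 = y.1 * x.2 ->
  \pi_localization x = \pi_localization y.
Proof.
move=> e; apply/eqmodP/asboolP; exists 1; first exact: denominators1.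
by rewrite e subrr mulr0.
Qed.

Lemma loc_addA : associative loc_add.
Proof.
elim/quotW=> x; elim/quotW=> y; elim/quotW=> z; rewrite !piE.
by apply: pi_eqf => /=; ring.
Qed.

Lemma loc_addC : commutative loc_add.
Proof.
elim/quotW=> x; elim/quotW=> y; rewrite !piE.
by apply: pi_eqf => /=; ring.
Qed.

Lemma loc_add0 : left_id (to_loc 0) loc_add.
Proof.
by elim/quotW=> x; rewrite /to_loc /loc_frac !piE; apply: pi_eqf => /=; ring.
Qed.

Lemma loc_addN : left_inverse (to_loc 0) loc_opp loc_add.
Proof.
by elim/quotW=> x; rewrite /to_loc /loc_frac !piE; apply: pi_eqf => /=; ring.
Qed.

HB.instance Definition _ :=
  GRing.isZmodule.Build localization loc_addA loc_addC loc_add0 loc_addN.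

Lemma loc_mulA : associative loc_mul.
Proof.
elim/quotW=> x; elim/quotW=> y; elim/quotW=> z; rewrite !piE.
by apply: pi_eqf => /=; ring.
Qed.

Lemma loc_mulC : commutative loc_mul.
Proof.
elim/quotW=> x; elim/quotW=> y; rewrite !piE.
by apply: pi_eqf => /=; ring.
Qed.

Lemma loc_mul1 : left_id (to_loc 1) loc_mul.
Proof.
by elim/quotW=> x; rewrite /to_loc /loc_frac !piE; apply: pi_eqf => /=; ring.
Qed.

Lemma loc_mulDl : left_distributive loc_mul loc_add.
Proof.
elim/quotW=> x; elim/quotW=> y; elim/quotW=> z; rewrite !piE.
by apply: pi_eqf => /=; ring.
Qed.

HB.instance Definition _ := GRing.Zmodule_isComPzRing.Build localization
  loc_mulA loc_mulC loc_mul1 loc_mulDl.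

End Localization.

Definition total_quotient_ring (R : comNzRingType) : comPzRingType :=
  localization [set s : R | forall x, s * x = 0 -> x = 0].

Definition to_total_quotient (R : comNzRingType) (a : R) :
  total_quotient_ring R := to_loc _ a.

Definition localization_at (R : comNzRingType) (p : set R) : comPzRingType :=
  localization (~` p).

Definition cm_ring (R : comNzRingType) :=
  noetherian R /\
  forall n : set R, maximal_ideal n -> cm_local_ring (localization_at n).

Section Cokernel.
Variables (R : comPzRingType) (M N : lmodType R) (f : {linear M -> N}).

Definition in_range : {pred N} := [pred y | `[< exists x, f x = y >]].

Lemma in_range_zmod_closed : zmod_closed in_range.
Proof.
split=> [|_ _ /asboolP[x <-] /asboolP[y <-]].
  by apply/asboolP; exists 0; rewrite linear0.
by apply/asboolP; exists (x - y); rewrite linearB.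
Qed.

HB.instance Definition _ := GRing.isZmodClosed.Build N in_range
  in_range_zmod_closed.

Definition coker := @Quotient.quot N in_range.

HB.instance Definition _ := GRing.Zmodule.on coker.
HB.instance Definition _ := EqQuotient.on coker.

Definition coker_scale (a : R) := lift_op1 coker ( *:%R a).

Lemma pi_coker_scale a : {morph \pi : x / a *: x >-> coker_scale a x}.
Proof.
move=> x; unlock coker_scale; apply/eqP; rewrite -Quotient.idealrBE.
have : x - repr (\pi_coker x) \in in_range.
  by rewrite Quotient.idealrBE reprK.
move=> /asboolP[y e]; apply/asboolP; exists (a *: y).
by rewrite linearZ /= e scalerBr.
Qed.
Canonical pi_coker_scale_morph a := PiMorph1 (pi_coker_scale a).

Lemma coker_scaleA a b x :
  coker_scale a (coker_scale b x) = coker_scale (a * b) x.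
Proof. by elim/quotW: x => x; rewrite !piE scalerA. Qed.

Lemma coker_scale1 : left_id 1 coker_scale.
Proof. by elim/quotW=> x; rewrite !piE scale1r. Qed.

Lemma coker_scaleDr : right_distributive coker_scale +%R.
Proof. by move=> a; elim/quotW=> x; elim/quotW=> y; rewrite !piE scalerDr. Qed.

Lemma coker_scaleDl x : {morph coker_scale^~ x : a b / a + b}.
Proof. by elim/quotW: x => x a b; rewrite !piE scalerDl. Qed.

HB.instance Definition _ := GRing.Zmodule_isLmodule.Build R coker
  coker_scaleA coker_scale1 coker_scaleDr coker_scaleDl.

End Cokernel.

Section LocalCohomology.
Variable R : comPzRingType.

Definition injective_module (I : lmodType R) :=
  forall (L N : lmodType R) (f : {linear L -> N}) (g : {linear L -> I}),
  injective f -> exists h : {linear N -> I}, forall x, h (f x) = g x.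

Record injective_resolution (N : lmodType R) := InjectiveResolution {
  res_mod : nat -> lmodType R;
  res_diff : forall i, {linear res_mod i -> res_mod i.+1};
  res_aug : {linear N -> res_mod 0};
  res_injective : forall i, injective_module (res_mod i);
  res_aug_inj : injective res_aug;
  res_exact0 : range res_aug = [set x | res_diff 0 x = 0];
  res_exactS : forall i, range (res_diff i) = [set x | res_diff i.+1 x = 0] }.

(* The m-torsion functor Gamma_m, whose i-th right derived functor is H^i_m. *)
Definition torsion (m : set R) (M : lmodType R) : set M :=
  [set v | exists k, forall a, ideal_pow m k a -> a *: v = 0].
Arguments torsion m M : clear implicits.

Section Cohomology.
Variables (m : set R) (N : lmodType R) (E : injective_resolution N).

Definition cocycles i : set (res_mod E i) :=
  torsion m (res_mod E i) `&` [set x | res_diff E i x = 0].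

Definition coboundaries i : set (res_mod E i) :=
  match i return set (res_mod E i) with
  | 0 => [set 0]
  | j.+1 => res_diff E j @` torsion m (res_mod E j)
  end.

End Cohomology.

Arguments cocycles m {N} E i.
Arguments coboundaries m {N} E i.

(* H^i_m(N) = 0. The cohomology of Gamma_m(E) does not depend, up to
   isomorphism, on the injective resolution E of N. *)
Definition local_cohomology_vanishes (m : set R) (N : lmodType R) (i : nat) :=
  forall E : injective_resolution N, cocycles m E i `<=` coboundaries m E i.

End LocalCohomology.

Arguments torsion {R} m M.

(* The inclusion of M into Mt is given as an injective linear map iota. For
   d = 0 the condition in degree d - 1 is void, as H^i_m = 0 for i < 0. *)
Definition is_cm_fication (R : comPzRingType) (m : set R) (M Mt : lmodType R)
    (iota : {linear M -> Mt}) :=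
  [/\ fg_module M, fg_module Mt, injective iota, cm_module m Mt
    & exists d, [/\ has_module_dim M d, has_module_dim Mt d,
        (0 < d)%N -> local_cohomology_vanishes m (coker iota) d.-1
      & local_cohomology_vanishes m (coker iota) d]].

(* The chain R <= B <= Q(R) is rendered by an R-algebra B with an injective ring
   morphism j to Q(R) that is compatible with the canonical maps from R. *)
Definition is_goto_cm_fication (R : comNzRingType) (m : set R)
    (B : comAlgType R) :=
  exists d, [/\ (2 <= d)%N, has_ring_dim R d,
      exists j : {rmorphism B -> total_quotient_ring R},
        injective j /\ forall a : R, j a%:A = to_total_quotient a,
      [/\ cm_ring B, fg_module B
        & forall n : set B, maximal_ideal n ->
            has_ring_dim (localization_at n) d]
    & forall (a : R) (b : B), m a -> exists c : R, a *: b = c%:A].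

Section StructureMap.
Variables (R : comNzRingType) (B : comAlgType R).

Definition structure_map (a : R^o) : B := (a : R)%:A.

Lemma structure_map_is_linear : linear structure_map.
Proof. by move=> a x y; rewrite /structure_map scalerDl scalerA. Qed.

HB.instance Definition _ := GRing.isLinear.Build R R^o B _ structure_map
  structure_map_is_linear.

End StructureMap.

Arguments structure_map {R} B.

(* Main.v *)
Require Import Defs.
From HB Require Import structures.
From mathcomp Require Import all_boot all_order all_algebra ring generic_quotient.
From mathcomp Require Import boolp classical_sets.

Set Implicit Arguments.
Unset Strict Implicit.
Unset Printing Implicit Defensive.

Import GRing.Theory.
Local Open Scope classical_set_scope.
Local Open Scope ring_scope.
Local Open Scope quotient_scope.

(** Since R embeds in B, both modules have annihilator 0 and hence the
    dimension d of R. What has to be shown is that B, as an R-module, has depth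
    d, and that the local cohomology of B/R vanishes in degrees d - 1 and d.

    Cohomology.  B/R is killed by m, and d - 1 >= 1, so it is enough that a
    module N in which every element is killed by a power of m has no local
    cohomology in positive degrees ([torsion_local_cohomology]).  Over a
    noetherian ring the torsion part T(E) of an injective module E is a direct
    summand ([torsion_projection]); this is Baer's argument, where a map from an
    ideal I to T(E) is first extended by zero to I + Q with Q containing a power
    of m, which is possible by a weak form of the Artin-Rees lemma
    ([weak_artin_rees]).  The projections onto the torsion parts then provide,
    degree by degree, a contraction of an injective resolution of N modulo its
    torsion subcomplex, so in positive degrees every torsion cocycle bounds a
    torsion cochain.

    Depth.  The hypothesis m B <= R makes I = m 1_B an ideal of the ring B
    ([extension_is_ideal]), so that B-regular sequences in m are the same as
    regular sequences of the ring B with terms in I.  Such a sequence s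
    generates a proper ideal, contained in a maximal ideal n of B; it remains
    regular in B_n, which has depth d, so its length is at most d
    ([regular_size_le_local_depth]).

    Conversely let s be a regular sequence in I that cannot be prolonged in I.
    By prime avoidance I lies in a prime P = ((s) : c) associated to B/(s)
    ([exists_nzd]).  As B is integral over R and P contains m, the ideal P is
    maximal ([prime_over_maximal_is_maximal]).  Hence in B_P the sequence s is
    regular and the maximal ideal kills the nonzero class of c modulo (s).
    A regular sequence of a noetherian module that ends with such a socle
    element is at least as long as any other one in the same ideal
    ([regular_exchange]), so s has length at least d. *)

(* The name span is also used for subspaces of finite-dimensional vector
   spaces. *)
Local Notation span := Defs.span.

(** * Submodules and regular sequences *)

Section Submodules.
Variables (R : comPzRingType) (M : lmodType R).
Implicit Types (N : set M) (A : set M).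

Lemma subm0 N : is_submodule N -> N 0. Proof. by case. Qed.

Lemma submD N x y : is_submodule N -> N x -> N y -> N (x + y).
Proof. by case=> _ + _; apply. Qed.

Lemma submZ N a x : is_submodule N -> N x -> N (a *: x).
Proof. by case=> _ _; apply. Qed.

Lemma submN N x : is_submodule N -> N x -> N (- x).
Proof. by move=> hN Nx; rewrite -scaleN1r; apply: submZ. Qed.

Lemma submB N x y : is_submodule N -> N x -> N y -> N (x - y).
Proof. by move=> hN Nx Ny; apply: submD => //; apply: submN. Qed.

Lemma span_submodule A : is_submodule (span A).
Proof.
split=> [N [hN _]|x y Ax Ay N hN|a x Ax N hN]; first exact: subm0.
  by apply: submD; [case: hN|apply: Ax|apply: Ay].
by apply: submZ; [case: hN|apply: Ax].
Qed.

Lemma sub_span A : A `<=` span A.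
Proof. exact: sub_gen_smallest. Qed.

Lemma span_sub A N : is_submodule N -> A `<=` N -> span A `<=` N.
Proof. exact: smallest_sub. Qed.

Lemma submodule0 : is_submodule [set 0 : M].
Proof.
split=> // [x y -> ->|a x ->]; first by rewrite /= addr0.
by rewrite /= scaler0.
Qed.

Definition noetherian_module :=
  forall N, is_submodule N -> fg_submodule N.

Lemma bigcup_submodule (F : nat -> set M) :
  (forall k, is_submodule (F k)) -> (forall k, F k `<=` F k.+1) ->
  is_submodule (\bigcup_k F k).
Proof.
move=> hF incF.
have mono j k : (j <= k)%N -> F j `<=` F k.
  by apply: homo_leq => [A|A B C|] //; apply: subset_trans.
split=> [|x y [j _ xj] [k _ yk]|a x [k _ xk]].
- by exists 0%N => //; apply: subm0.
- exists (maxn j k) => //; apply: submD => //.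
    by apply: mono xj; apply: leq_maxl.
  by apply: mono yk; apply: leq_maxr.
- by exists k => //; apply: submZ.
Qed.

(** Otherwise there is a strictly increasing sequence in the family; its union
    is generated by finitely many elements, which already lie in one of the
    terms. *)
Lemma noetherian_maximal (P : set (set M)) N0 :
  noetherian_module -> (forall N, P N -> is_submodule N) -> P N0 ->
  exists2 N, P N & forall N', P N' -> N `<=` N' -> N' `<=` N.
Proof.
move=> noeth subP PN0; apply: contrapT => nomax.
have next N : exists N', P N -> [/\ P N', N `<=` N' & ~ (N' `<=` N)].
  have [PN|nPN] := pselect (P N); last by exists N.
  apply: contrapT => nonext; apply: nomax; exists N => // N' PN' NN'.
  by apply: contrapT => nN'N; apply: nonext; exists N'.
have [f fP] := choice next; pose F k := iter k f N0.
have PF k : P (F k) by elim: k => // k IH; have [] := fP _ IH.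
have incF k : F k `<=` F k.+1 by have [] := fP _ (PF k).
have mono j k : (j <= k)%N -> F j `<=` F k.
  by apply: homo_leq => [A|A B C|] //; apply: subset_trans.
have [s es] := noeth _ (bigcup_submodule (fun k => subP _ (PF k)) incF).
have [k sk] : exists k, [set` s] `<=` F k.
  have : [set` s] `<=` \bigcup_k F k by rewrite -es; apply: sub_span.
  elim: s {es} => [|x s IH] sF; first by exists 0%N.
  have [j sj] : exists j, [set` s] `<=` F j.
    by apply: IH => y ys; apply: sF; rewrite /= inE ys orbT.
  have [k _ xk] : (\bigcup_k F k) x by apply: sF; rewrite /= mem_head.
  exists (maxn j k) => y /=; rewrite inE => /orP[/eqP->|ys].
    by apply: mono xk; apply: leq_maxr.
  by apply: (mono j); [apply: leq_maxl|apply: sj].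
have [_ _] := fP _ (PF k); apply => x xk1.
have : (\bigcup_k F k) x by exists k.+1.
by rewrite -es; apply: span_sub => //; apply: subP.
Qed.

Definition colon N (c : M) : set R := [set a | N (a *: c)].

Lemma colon_ideal N c : is_submodule N -> is_ideal (colon N c).
Proof.
move=> hN; split=> [|a b|a b]; rewrite /colon /=.
- by rewrite scale0r; apply: subm0.
- by rewrite scalerDl; apply: submD.
- by rewrite -scalerA; apply: submZ.
Qed.

Definition nzd_mod N (a : R) := forall v, N (a *: v) -> N v.

(** This is N + a M. *)
Definition adj N (a : R) : set M :=
  [set v | exists2 u, N u & exists w, v = u + a *: w].

Lemma adj_submodule N a : is_submodule N -> is_submodule (adj N a).
Proof.
move=> hN; split=> [|x y [u Nu [w ->]] [v Nv [t ->]]|b x [u Nu [w ->]]].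
- by exists 0; [apply: subm0|exists 0; rewrite scaler0 addr0].
- exists (u + v); first exact: submD.
  by exists (w + t); rewrite scalerDr addrACA.
- exists (b *: u); first exact: submZ.
  by exists (b *: w); rewrite scalerDr !scalerA mulrC.
Qed.

Lemma sub_adj N a : N `<=` adj N a.
Proof. by move=> u Nu; exists u => //; exists 0; rewrite scaler0 addr0. Qed.

Lemma adj_scale N a w : is_submodule N -> adj N a (a *: w).
Proof. by move=> hN; exists 0; [apply: subm0|exists w; rewrite add0r]. Qed.

Lemma adj_sub N N' a : is_submodule N' -> N `<=` N' ->
  (forall w, N' (a *: w)) -> adj N a `<=` N'.
Proof. by move=> hN' NN' aN' _ [u /NN' ? [w ->]]; apply: submD. Qed.

Lemma adjC N a b : adj (adj N a) b = adj (adj N b) a.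
Proof.
suff swap c d : adj (adj N c) d `<=` adj (adj N d) c.
  by apply/seteqP; split; apply: swap.
move=> _ [_ [u Nu [w ->]] [t ->]]; exists (u + d *: t); first by exists u => //; exists t.
by exists w; rewrite addrAC.
Qed.

(** This is N + s_0 M + ... + s_k M. *)
Definition gen N s := foldl adj N s.

Lemma gen_submodule N s : is_submodule N -> is_submodule (gen N s).
Proof. by elim: s N => //= a s IH N hN; apply/IH/adj_submodule. Qed.

Lemma sub_gen N s : N `<=` gen N s.
Proof.
elim: s N => [|a s IH] N //=; apply: subset_trans (IH _).
exact: sub_adj.
Qed.

Lemma gen_rcons N s a : gen N (rcons s a) = adj (gen N s) a.
Proof. by rewrite /gen foldl_rcons. Qed.

Lemma gen_adj N s a : gen (adj N a) s = adj (gen N s) a.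
Proof. by elim: s N => //= b s IH N; rewrite adjC IH. Qed.

Lemma gen_scale N s a w : is_submodule N -> a \in s -> gen N s (a *: w).
Proof.
elim: s N => //= b s IH N hN; rewrite inE => /orP[/eqP <-|].
  by apply: sub_gen; apply: adj_scale.
by apply: IH; apply: adj_submodule.
Qed.

Lemma gen_sub N N' s : is_submodule N' -> N `<=` N' ->
  (forall a w, a \in s -> N' (a *: w)) -> gen N s `<=` N'.
Proof.
elim: s N => //= a s IH N hN' NN' sN'; apply: IH => //.
  by apply: adj_sub => // w; apply: sN'; rewrite mem_head.
by move=> b w bs; apply: sN'; rewrite inE bs orbT.
Qed.

Lemma scale_submoduleE s : scale_submodule M [set` s] = gen [set 0] s.
Proof.
apply/seteqP; split.
  apply: span_sub; first exact/gen_submodule/submodule0.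
  by move=> _ [a sa [w _ <-]]; apply: gen_scale => //; apply: submodule0.
apply: gen_sub; first exact: span_submodule.
  by move=> _ ->; apply: subm0; apply: span_submodule.
by move=> a w sa; apply: sub_span; exists a => //; exists w.
Qed.

(** This is M/N-regularity without the requirement that N + s M be proper;
    working modulo a submodule of a fixed M avoids quotient modules. *)
Fixpoint regular_mod N s :=
  if s is a :: s' then nzd_mod N a /\ regular_mod (adj N a) s' else True.

Lemma regular_mod_rcons N s a :
  regular_mod N (rcons s a) <-> regular_mod N s /\ nzd_mod (gen N s) a.
Proof.
elim: s N => [|b s IH] N /=; first by split=> -[].
by split=> [[? /IH[]]|[[? ?] ?]]; split=> //; apply/IH.
Qed.

Lemma regular_modP N s : regular_mod N s <->
  forall i, (i < size s)%N -> nzd_mod (gen N (take i s)) (nth 0 s i).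
Proof.
elim: s N => [|a s IH] N /=; first by split.
split=> [[na /IH rs] [|i] //= /rs //|rs].
by split; [apply: (rs 0%N)|apply/IH => i; apply: (rs i.+1)].
Qed.

Lemma regular_sequenceE s :
  regular_sequence M s <-> regular_mod [set 0] s /\ gen [set 0] s <> setT.
Proof.
rewrite /regular_sequence scale_submoduleE regular_modP.
split=> -[rs ns]; split=> // i si v; have := rs i si v;
  by rewrite /= !scale_submoduleE.
Qed.

End Submodules.

(** * Associated primes and prime avoidance *)

Section AssociatedPrimes.
Variable R : comPzRingType.

Lemma prime_avoids_inter (P : set R) (Qs : seq (set R)) : prime_ideal P ->
  (forall Q, Q \in Qs -> is_ideal Q /\ ~ Q `<=` P) ->
  exists2 p, ~ P p & forall Q, Q \in Qs -> Q p.
Proof.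
move=> [idP nP1 primeP]; elim: Qs => [|Q Qs IH] hQ; first by exists 1.
have [|p nPp Qsp] := IH; first by move=> Q' Q'Qs; apply: hQ; rewrite inE Q'Qs orbT.
have [idQ /existsNP[q /not_implyP[Qq nPq]]] := hQ Q (mem_head _ _).
exists (p * q) => [/primeP[]//|Q']; rewrite inE => /orP[/eqP->|Q'Qs].
  exact: (submZ p idQ).
have [idQ' _] : is_ideal Q' /\ ~ Q' `<=` P by apply: hQ; rewrite inE Q'Qs orbT.
by rewrite mulrC; apply: (submZ q idQ'); apply: Qsp.
Qed.

(** When an element z avoiding all the primes but P lies in P, it is corrected by
    an element of n and of all the other primes that is not in P. Such an element
    exists unless some Q in the list is contained in P, and then avoiding P
    entails avoiding Q, which can be dropped. *)
Lemma prime_avoidance (n : set R) (Ps : seq (set R)) : is_ideal n ->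
  (forall P, P \in Ps -> prime_ideal P /\ ~ n `<=` P) ->
  exists2 z, n z & forall P, P \in Ps -> ~ P z.
Proof.
move=> idn; have [k sk] := ubnP (size Ps); elim: k Ps sk => // k IH [|P Ps] /= sk hP.
  by exists 0; first exact: subm0 idn.
have [primeP nP] := hP P (mem_head _ _).
have hPs Q : Q \in Ps -> prime_ideal Q /\ ~ n `<=` Q.
  by move=> QPs; apply: hP; rewrite inE QPs orbT.
have [[Q QPs QP]|noQ] := pselect (exists2 Q, Q \in Ps & Q `<=` P).
  have [||z nz zP] := IH (P :: rem Q Ps).
  - by rewrite /= size_rem // prednK //; case: (Ps) QPs.
  - by move=> P'; rewrite inE => /orP[/eqP->//|/mem_rem]; apply: hPs.
  exists z => // P' P'Ps; have [->|P'Q] := eqVneq P' Q.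
    by move/QP; apply: zP; rewrite mem_head.
  apply: zP; move: P'Ps; rewrite !inE => /orP[->//|P'Ps].
  by rewrite (rem_mem P'Q P'Ps) orbT.
have [//|//|z nz zPs] := IH Ps.
have [Pz|nPz] := pselect (P z); last first.
  by exists z => // P'; rewrite inE => /orP[/eqP->|/zPs].
have [|w nPw hw] := prime_avoids_inter (Qs := n :: Ps) primeP.
  move=> Q; rewrite inE => /orP[/eqP->//|QPs]; split; first by have [[]] := hPs Q QPs.
  by move=> QP; apply: noQ; exists Q.
exists (z + w) => [|P']; first by apply: submD (idn) nz _; apply: hw; rewrite mem_head.
rewrite inE => /orP[/eqP-> Pzw|P'Ps P'zw].
  have [idP _ _] := primeP; apply: nPw.
  by rewrite -[w](addKr z) addrC; apply: submB idP _ Pz.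
have [[idP' _ _] _] := hPs _ P'Ps; apply: (zPs _ P'Ps).
rewrite -[z](addrK w); apply: submB idP' P'zw _.
by apply: hw; rewrite inE P'Ps orbT.
Qed.

Variable M : lmodType R.
Implicit Type N : set M.

Definition associated_prime N (P : set R) :=
  prime_ideal P /\ exists2 c, ~ N c & P = colon N c.

Let maximal_colon N c := ~ N c /\
  forall d, ~ N d -> colon N c `<=` colon N d -> colon N d `<=` colon N c.

Let maximal_colon_prime N c :
  is_submodule N -> maximal_colon N c -> prime_ideal (colon N c).
Proof.
move=> hN [nNc maxc]; split; first exact: colon_ideal.
  by rewrite /colon /= scale1r.
move=> x y; rewrite /colon /= => xyc.
have [Nxc|nNxc] := pselect (N (x *: c)); [by left|right].
apply: (maxc (x *: c) nNxc) => [a|]; rewrite /colon /= scalerA; last by rewrite mulrC.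
by rewrite mulrC -scalerA; apply: submZ.
Qed.

Hypotheses (noethR : noetherian R) (noethM : noetherian_module M).

(** Every zero divisor modulo N lies in a maximal element (N : c) of the set of
    all (N : v) with v outside N, and such a maximal element is prime. Finitely
    many of these c generate all of them; if c is a combination of c_1, ..., c_r,
    the intersection of the (N : c_i) is contained in the prime (N : c), so some
    (N : c_i) is, and it equals (N : c) by maximality. *)
Lemma zero_divisors_cover N : is_submodule N -> exists2 Ps : seq (set R),
  forall P, P \in Ps -> associated_prime N P &
  forall a, ~ nzd_mod N a -> exists2 P, P \in Ps & P a.
Proof.
move=> hN.
have [||K [s smax Ks] Kmax] := @noetherian_maximal _ _
    [set K | exists2 s : seq M, (forall c, c \in s -> maximal_colon N c) &
      K = span [set` s]] (span [set` [::]]) noethM.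
- by move=> K [s _ ->]; apply: span_submodule.
- by exists [::].
exists [seq colon N c | c <- s] => [_ /mapP[c /smax cmax ->]|a].
  by split; [apply: maximal_colon_prime|exists c => //; case: cmax].
move=> /existsNP[v /not_implyP[Nav nNv]].
have [||_ [[c nNc ->] vc] cmax] := @noetherian_maximal _ R^o
    [set I | (exists2 c, ~ N c & I = colon N c) /\ colon N v `<=` I]
    (colon N v) noethR.
- by move=> I [[c _ ->] _]; apply: colon_ideal.
- by split=> //; exists v.
have {}cmax : maximal_colon N c.
  split=> // d nNd cd; apply: (cmax (colon N d)) (cd).
  by split; [exists d|apply: subset_trans cd].
have primec := maximal_colon_prime hN cmax.
have sc : span [set` s] c.
  rewrite -Ks; apply: (Kmax (span [set` c :: s])); last first.
  - by apply: sub_span; rewrite /= mem_head.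
  - rewrite Ks; apply: span_sub; first exact: span_submodule.
    by move=> x xs; apply: sub_span; rewrite /= inE (xs : x \in s) orbT.
  - exists (c :: s) => // x; rewrite inE => /orP[/eqP->//|]; exact: smax.
have [d ds dc] : exists2 d, d \in s & colon N d `<=` colon N c.
  apply: contrapT => nod.
  have [|p ncp ps] := prime_avoids_inter (Qs := [seq colon N d | d <- s]) primec.
    move=> _ /mapP[d ds ->]; split; first exact: colon_ideal.
    by move=> dc; apply: nod; exists d.
  apply: ncp; rewrite /colon /=.
  have: [set x | N (p *: x)] c; last by [].
  apply: span_sub sc.
    split=> [|x y|b x]; rewrite /= ?scaler0 ?scalerDr; first exact: subm0.
      exact: submD.
    by rewrite scalerA mulrC -scalerA; apply: submZ.
  by move=> d ds; apply: (ps (colon N d)); apply: map_f.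
exists (colon N d); first exact: map_f.
by have [_ dmax] := smax d ds; exact: (dmax c nNc dc a (vc a Nav)).
Qed.

Lemma exists_nzd (n : set R) (Ns : seq (set M)) : is_ideal n ->
  (forall N, N \in Ns -> is_submodule N) ->
  (forall N P, N \in Ns -> associated_prime N P -> ~ n `<=` P) ->
  exists2 z, n z & forall N, N \in Ns -> nzd_mod N z.
Proof.
move=> idn hNs nP.
have [Ps hPs cover] : exists2 Ps : seq (set R),
    forall P, P \in Ps -> prime_ideal P /\ ~ n `<=` P &
    forall N a, N \in Ns -> ~ nzd_mod N a -> exists2 P, P \in Ps & P a.
  elim: Ns hNs nP => [|N Ns IH] hNs nP; first by exists [::].
  have [N' N'Ns|N' P N'Ns|Ps hPs cover] := IH.
  - by apply: hNs; rewrite inE N'Ns orbT.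
  - by apply: nP; rewrite inE N'Ns orbT.
  have [Ps' hPs' cover'] := zero_divisors_cover (hNs N (mem_head _ _)).
  exists (Ps' ++ Ps) => [P|N' a].
    rewrite mem_cat => /orP[/hPs' NP|/hPs//]; split; first by case: NP.
    by apply: nP NP; rewrite mem_head.
  rewrite inE => /orP[/eqP->|N'Ns] za.
    by have [P PPs Pa] := cover' a za; exists P => //; rewrite mem_cat PPs.
  by have [P PPs Pa] := cover N' a N'Ns za; exists P => //; rewrite mem_cat PPs orbT.
have [z nz zP] := prime_avoidance idn hPs; exists z => // N /cover Nz.
by apply: contrapT => /Nz[P /zP].
Qed.

(** * Exchange of regular sequences *)

(** These are the submodules N + s_0 M + ... + s_{j-1} M, for all j. *)
Fixpoint prefixes N s :=
  N :: if s is a :: s' then prefixes (adj N a) s' else [::].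

Lemma gen_in_prefixes N s : gen N s \in prefixes N s.
Proof. by elim: s N => [|a s IH] N /=; rewrite inE ?eqxx // IH orbT. Qed.

(** The sequence s, z is regular, and z can be moved to the front because it is
    regular modulo every prefix: if a v = u + z w, then w = u' + a w' because z is
    regular modulo N + a M, and a cancels in a (v - z w') = u + z u'. *)
Lemma regular_mod_add_nzd N s z : is_submodule N -> regular_mod N s ->
  (forall K, K \in prefixes N s -> nzd_mod K z) -> regular_mod (adj N z) s.
Proof.
elim: s N => //= a s IH N hN [na rs] nz; split; last first.
  rewrite adjC; apply: IH => // [|K Ks]; first exact: adj_submodule.
  by apply: nz; rewrite inE Ks orbT.
move=> v [u Nu [w avE]].
have : adj N a w.
  apply: (nz (adj N a)).
    by rewrite inE; apply/orP; right; case: (s) => *; rewrite /= mem_head.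
  by exists (- u); [apply: submN|exists v; rewrite avE addKr].
move=> [u' Nu' [w' wE]].
have Nvw : N (v - z *: w').
  apply: na; rewrite scalerBr avE wE scalerDr !scalerA [z * a]mulrC.
  by rewrite addrA addrK; apply: submD => //; apply: submZ.
by exists (v - z *: w') => //; exists w'; rewrite subrK.
Qed.

Lemma prefixes_have_nzd (n : set R) N s x : is_submodule N ->
  (forall a, a \in rcons s x -> n a) -> regular_mod N (rcons s x) ->
  forall K, K \in prefixes N s ->
  is_submodule K /\ exists2 a, n a & nzd_mod K a.
Proof.
elim: s N => [|a s IH] N hN sn /= [na rs] K.
  rewrite mem_seq1 => /eqP->; split=> //; exists x => //.
  by apply: sn; rewrite mem_head.
rewrite inE => /orP[/eqP->|].
  by split=> //; exists a => //; apply: sn; rewrite mem_head.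
apply: IH => //; first exact: adj_submodule.
by move=> b bs; apply: sn; rewrite inE bs orbT.
Qed.

(** The socles of C/xC and C/zC are isomorphic for C = M/N, because x and z are
    both regular on C: a socle element c of C/xC satisfies z c = x d in C, and d is
    the corresponding socle element of C/zC. *)
Lemma socle_exchange (n : set R) N x z c : is_submodule N ->
  n x -> n z -> nzd_mod N x -> nzd_mod N z ->
  ~ adj N x c -> n `<=` colon (adj N x) c ->
  exists2 d, ~ adj N z d & n `<=` colon (adj N z) d.
Proof.
move=> hN nx nz regx regz nc nnc; have [u Nu [d zc]] := nnc z nz.
exists d => [[v Nv [e dE]]|a na].
  apply: nc; exists (c - x *: e); last by exists e; rewrite subrK.
  apply: regz; rewrite scalerBr zc dE scalerDr !scalerA [z * x]mulrC addrA addrK.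
  by apply: submD => //; apply: submZ.
have [v Nv [e ac]] := nnc a na; rewrite /colon /=.
have Nade : N (a *: d - z *: e).
  apply: regx; have -> : x *: (a *: d - z *: e) = z *: v - a *: u.
    have -> : v = a *: c - x *: e by rewrite ac addrK.
    have -> : u = z *: c - x *: d by rewrite zc addrK.
    rewrite !scalerBr !scalerA [z * a]mulrC [x * a]mulrC [x * z]mulrC.
    by rewrite opprB [RHS]addrC addrA subrK.
  by apply: submB => //; apply: submZ.
by exists (a *: d - z *: e) => //; exists e; rewrite subrK.
Qed.

(** The conditions on c say that it represents a nonzero element of the socle of
    M/(N + s M) with respect to n. Prime avoidance gives an element z of n that is
    regular modulo all the prefixes of s and of t, the full sequences excepted.
    It can replace the last term of s, by [socle_exchange], and the last term of
    t. Moving z to the front and passing to N + z M shortens both sequences by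
    one term. *)
Theorem regular_exchange (n : set R) N s t c : is_ideal n -> is_submodule N ->
  (forall a, a \in s -> n a) -> regular_mod N s ->
  ~ gen N s c -> n `<=` colon (gen N s) c ->
  (forall a, a \in t -> n a) -> regular_mod N t -> (size t <= size s)%N.
Proof.
move=> idn; elim/last_ind: s N t c => [|s x IH] N t c hN sn rs nc nnc.
  case: t => // a t tn /= [ra _]; case: nc; apply: ra.
  by apply: (nnc a); apply: tn; rewrite mem_head.
elim/last_ind: t => // t y _ tn rt.
(* A prefix has no associated prime that contains n: the next term is regular
   on it. *)
have [||z nz zreg] := @exists_nzd n (prefixes N s ++ prefixes N t) idn.
- move=> K; rewrite mem_cat.
  by move=> /orP[/(prefixes_have_nzd hN sn rs)|/(prefixes_have_nzd hN tn rt)][].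
- move=> K P Kst [_ [d nKd ->]] nP.
  have [a na Ka] : exists2 a, n a & nzd_mod K a.
    move: Kst; rewrite mem_cat.
    by move=> /orP[/(prefixes_have_nzd hN sn rs)|/(prefixes_have_nzd hN tn rt)][].
  by apply: nKd; apply: Ka; apply: nP.
move: rs rt nc nnc; rewrite !regular_mod_rcons gen_rcons => -[rs rx] [rt ry] nc nnc.
have [||d nd nnd] := socle_exchange (gen_submodule s hN) _ nz rx _ nc nnc.
- by apply: sn; rewrite mem_rcons mem_head.
- by apply: zreg; rewrite mem_cat gen_in_prefixes.
rewrite -gen_adj in nd nnd; rewrite !size_rcons ltnS.
apply: IH nd nnd _ _; first exact: adj_submodule.
- by move=> a ? ; apply: sn; rewrite mem_rcons inE orbC; apply/orP; left.
- by apply: regular_mod_add_nzd => // K Ks; apply: zreg; rewrite mem_cat Ks.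
- by move=> a ? ; apply: tn; rewrite mem_rcons inE orbC; apply/orP; left.
- by apply: regular_mod_add_nzd => // K Ks; apply: zreg; rewrite mem_cat Ks orbT.
Qed.

End AssociatedPrimes.

(** * Maximal ideals *)

Section MaximalIdeals.
Variable R : comPzRingType.

Lemma maximal_prime (n : set R) : maximal_ideal n -> prime_ideal n.
Proof.
move=> [idn n1 maxn]; split=> // x y nxy.
have [nx|nnx] := pselect (n x); [by left|right].
have [u nu [w e]] : adj (M := R^o) n x 1.
  apply: contrapT => nadj1; apply: nnx.
  have idadj := @adj_submodule _ R^o n x idn.
  rewrite -(maxn (adj (M := R^o) n x) idadj nadj1 (@sub_adj _ R^o n x)).
  by have := @adj_scale _ R^o n x 1 idn; rewrite /GRing.scale /= mulr1.
rewrite -[y]mul1r e mulrDl; apply: (submD idn).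
  by rewrite mulrC; apply: (submZ y idn).
by rewrite -[x *: w]/(x * w) mulrAC mulrC; apply: (submZ w idn).
Qed.

Lemma exists_maximal (J : set R) : noetherian R -> is_ideal J -> ~ J 1 ->
  exists2 n, maximal_ideal n & J `<=` n.
Proof.
move=> noeth idJ J1.
have [I [] //||n [idn n1 Jn] maxn] := @noetherian_maximal _ R^o
    [set I | [/\ is_ideal I, ~ I 1 & J `<=` I]] J noeth.
  by split.
exists n => //; split=> // I idI I1 nI; apply/seteqP; split=> //.
by apply: maxn => //; split=> //; apply: subset_trans nI.
Qed.

Lemma local_nonunit (m : set R) x : noetherian R -> local_ring m ->
  (forall y, x * y <> 1) -> m x.
Proof.
move=> noeth [_ uniqm] xN.
have idx : is_ideal (adj (M := R^o) [set 0] x).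
  exact/adj_submodule/(@submodule0 R R^o).
have [|n maxn xn] := exists_maximal noeth idx.
  by move=> [_ -> [w]]; rewrite add0r => e; apply: (xN w).
rewrite -(uniqm n maxn); apply: xn; exists 0 => //; exists 1.
by rewrite add0r /GRing.scale /= mulr1.
Qed.

End MaximalIdeals.

(** * Localization of regular sequences *)

Section LocalizationOfIdeals.
Variables (R : comNzRingType) (S : set R).
Local Notation A := (localization S).
Implicit Types J : set R.

Lemma loc_fracE a s b t (hs : denominators S s) (ht : denominators S t) :
  loc_frac a hs = loc_frac b ht <->
  exists2 u, denominators S u & u * (a * t - b * s) = 0.
Proof.
split=> [/eqmodP/asboolP|e]; first by [].
by apply/eqmodP/asboolP.
Qed.

Lemma loc_fracD a s b t (hs : denominators S s) (ht : denominators S t) :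
  loc_frac a hs + loc_frac b ht =
  loc_frac (a * t + b * s) (denominatorsM hs ht).
Proof. by rewrite -[LHS]/(loc_add _ _) /loc_frac !piE; congr (\pi _); apply: val_inj. Qed.

Lemma loc_fracM a s b t (hs : denominators S s) (ht : denominators S t) :
  loc_frac a hs * loc_frac b ht = loc_frac (a * b) (denominatorsM hs ht).
Proof. by rewrite -[LHS]/(loc_mul _ _) /loc_frac !piE; congr (\pi _); apply: val_inj. Qed.

Lemma loc_fracP (x : A) : exists a s (hs : denominators S s), x = loc_frac a hs.
Proof.
elim/quotW: x => -[[a s] hs]; exists a, s, (elimT (asboolP _) hs).
by rewrite /loc_frac /mkfrac (Prop_irrelevance (introT _ _) hs).
Qed.

Definition loc_ideal J : set A^o :=
  [set x | exists a s (hs : denominators S s), J a /\ x = loc_frac a hs].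

Lemma loc_ideal_frac J a s (hs : denominators S s) : is_ideal J ->
  loc_ideal J (loc_frac a hs) <-> exists2 t, denominators S t & J (t * a).
Proof.
move=> idJ; split=> [[b [r [hr [Jb /loc_fracE[u hu e]]]]]|[t ht Jta]].
  exists (u * r); first exact: denominatorsM.
  have -> : u * r * a = u * s * b.
    by apply/eqP; rewrite -subr_eq0 -e mulrBr !mulrA [u * a * r]mulrAC [u * b * s]mulrAC.
  exact: (submZ (u * s) idJ).
exists (t * a), (t * s), (denominatorsM ht hs); split=> //; apply/loc_fracE.
by exists 1; [apply: denominators1|rewrite mul1r mulrCA mulrA subrr].
Qed.

Lemma loc_ideal_ideal J : is_ideal J -> is_ideal (loc_ideal J).
Proof.
move=> idJ; split.
- by exists 0, 1, (@denominators1 _ S); split; first exact: subm0 idJ.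
- move=> _ _ [a [s [hs [Ja ->]]]] [b [t [ht [Jb ->]]]].
  rewrite loc_fracD; do 3 eexists; split; last by reflexivity.
  by apply: (submD idJ); rewrite mulrC; apply: (submZ _ idJ).
- move=> y _ [a [s [hs [Ja ->]]]]; have [b [t [ht ->]]] := loc_fracP y.
  rewrite /GRing.scale /= loc_fracM; do 3 eexists; split; last by reflexivity.
  exact: (submZ b idJ).
Qed.

Lemma loc_ideal_sub J J' : J `<=` J' -> loc_ideal J `<=` loc_ideal J'.
Proof. by move=> JJ' _ [a [s [hs [/JJ' Ja ->]]]]; exists a, s, hs. Qed.

Lemma loc_ideal0 : loc_ideal [set 0] = [set 0].
Proof.
apply/seteqP; split=> [_ [_ [s [hs [-> ->]]]]|_ ->].
  by apply/loc_fracE; exists 1; [apply: denominators1|rewrite !mul0r subrr mulr0].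
by exists 0, 1, (@denominators1 _ S).
Qed.

Lemma nzd_loc J a : is_ideal J -> nzd_mod (M := R^o) J a ->
  nzd_mod (loc_ideal J) (to_loc S a).
Proof.
move=> idJ reg v; have [b [s [hs ->]]] := loc_fracP v.
rewrite /GRing.scale /= loc_fracM !loc_ideal_frac // => -[t ht].
by rewrite mulrCA => /reg; exists t.
Qed.

Lemma loc_ideal_adj J a : is_ideal J ->
  loc_ideal (adj (M := R^o) J a) = adj (loc_ideal J) (to_loc S a).
Proof.
move=> idJ; have idadj := @adj_submodule _ R^o J a idJ.
apply/seteqP; split=> [_ [_ [s [hs [[u Ju [w ->]] ->]]]]|].
  exists (@loc_frac R S u s hs : A); first by exists u, s, hs.
  exists (@loc_frac R S w s hs : A); rewrite /GRing.scale /= loc_fracM loc_fracD.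
  by apply/loc_fracE; exists 1; [apply: denominators1|ring].
apply: adj_sub; first exact: loc_ideal_ideal.
  exact: (loc_ideal_sub (@sub_adj _ R^o J a)).
move=> w; have [b [s [hs ->]]] := loc_fracP w.
rewrite /GRing.scale /= loc_fracM; do 3 eexists; split; last by reflexivity.
exact: (adj_scale (M := R^o)).
Qed.

Lemma loc_ideal_gen J s : is_ideal J ->
  loc_ideal (gen (M := R^o) J s) = gen (loc_ideal J) (map (to_loc S) s).
Proof.
elim: s J => //= a s IH J idJ.
by rewrite IH ?loc_ideal_adj //; apply: adj_submodule.
Qed.

Lemma regular_loc J s : is_ideal J -> regular_mod (M := R^o) J s ->
  regular_mod (loc_ideal J) (map (to_loc S) s).
Proof.
elim: s J => //= a s IH J idJ [ra rs]; split; first exact: nzd_loc.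
by rewrite -loc_ideal_adj //; apply: IH => //; apply: adj_submodule.
Qed.

End LocalizationOfIdeals.

Section LocalizationAtMaximal.
Variables (R : comNzRingType) (n : set R) (maxn : maximal_ideal n).
Let S := ~` n.
Let A := localization_at n.

Let loc_den s : denominators S s -> ~ n s.
Proof.
have [_ n1 primen] := maximal_prime maxn.
by move/(_ (~` n)); apply; split=> //; split=> // x y nx ny /primen[].
Qed.

Variables (d : nat) (m : set A).
Hypotheses (noethA : noetherian A) (localm : local_ring m)
  (depthm : has_depth m A^o d).

Lemma loc_frac_in_max a s (hs : denominators S s) : m (loc_frac a hs : A) <-> n a.
Proof.
have [[idm m1 _] _] := localm; have [idn n1 _] := maxn.
split=> [ma|na].
  apply: contrapT => nna; apply: m1.
  have ha : denominators S a by apply: sub_gen_smallest.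
  have -> : 1 = loc_frac s ha * loc_frac a hs :> A.
    rewrite loc_fracM; apply/loc_fracE; exists 1; first exact: denominators1.
    by rewrite mul1r mul1r mulr1 [s * a]mulrC subrr.
  exact: (submZ (M := A^o)).
apply: local_nonunit => // y; have [b [t [ht ->]]] := loc_fracP y.
rewrite loc_fracM => /loc_fracE[u hu /eqP].
rewrite mulr1 mul1r mulrBr subr_eq0 => /eqP e.
apply: (loc_den (denominatorsM hu (denominatorsM hs ht))).
by rewrite -e mulrA mulrAC; apply: (submZ (u * b) idn).
Qed.

(** As n contains s, the localization of the ideal (s) at n is a proper ideal, so
    s stays regular, in the strict sense, in the localization. *)
Lemma regular_size_le_local_depth s :
  (forall a, a \in s -> n a) -> regular_mod (M := R^o) [set 0] s ->
  (size s <= d)%N.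
Proof.
have id0 := @submodule0 R R^o; have [_ le_d] := depthm.
move=> sn rs; rewrite -(size_map (to_loc S)); apply: le_d; split.
  by move=> _ /= /mapP[a /sn na ->]; apply/loc_frac_in_max.
apply/regular_sequenceE; split; first by rewrite -loc_ideal0; apply: regular_loc.
rewrite -loc_ideal0 -loc_ideal_gen // => /seteqP[_ /(_ (loc_frac 1 (@denominators1 _ S)) I)].
rewrite loc_ideal_frac; last exact: gen_submodule.
move=> [t /loc_den nt]; rewrite mulr1 => gt; apply: nt.
have [idn _ _] := maxn.
have := @gen_sub _ R^o [set 0] n s idn; apply => [x ->|a w /sn na|//].
  exact: subm0 idn.
by rewrite /GRing.scale /= mulrC; apply: (submZ _ idn).
Qed.

(** In the localization at n = ((s) : c) the class of c modulo (s) is not zero and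
    is killed by the maximal ideal, so [regular_exchange] compares s with a
    regular sequence of length d. *)
Lemma local_depth_le_regular_size s c :
  (forall a, a \in s -> n a) -> regular_mod (M := R^o) [set 0] s ->
  n = colon (M := R^o) (gen [set 0] s) c -> (d <= size s)%N.
Proof.
have id0 := @submodule0 R R^o; have idg := gen_submodule s id0.
have [[t [tm /regular_sequenceE[rt _]] <-] _] := depthm.
move=> sn rs nE; rewrite -(size_map (to_loc S) s).
have [idm _ _] := localm.1.
apply: (regular_exchange (M := A^o) noethA noethA idm (submodule0 _)
  (c := to_loc S c) _ _ _ _ tm rt).
- by move=> _ /= /mapP[a /sn na ->]; apply/loc_frac_in_max.
- by rewrite -loc_ideal0; apply: regular_loc.
- rewrite -loc_ideal0 -loc_ideal_gen // loc_ideal_frac // => -[u /loc_den nu guc].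
  by apply: nu; rewrite nE.
- move=> x; have [a [r [hr ->]]] := loc_fracP x; move/loc_frac_in_max => na.
  have gac : gen (M := R^o) [set 0] s (a * c) by move: na; rewrite nE.
  rewrite /colon /=; rewrite -loc_ideal0 -loc_ideal_gen //.
  rewrite /GRing.scale /= loc_fracM loc_ideal_frac //.
  exists 1; first exact: denominators1.
  by rewrite mul1r.
Qed.

End LocalizationAtMaximal.

(** * Finite algebras over a local ring *)

Section FiniteAlgebras.
Variables (R : comNzRingType) (B : comAlgType R).

Lemma span_seqP (M : lmodType R) (s : seq M) v : span [set` s] v ->
  exists r : nat -> R, v = \sum_(i < size s) r i *: s`_i.
Proof.
pose C := [set v | exists r : nat -> R, v = \sum_(i < size s) r i *: s`_i].
apply: (@span_sub _ _ [set` s] C).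
  split=> [|x y [r ->] [t ->]|a x [r ->]].
  - by exists (fun=> 0); rewrite big1 // => i _; rewrite scale0r.
  - exists (fun i => r i + t i); rewrite -big_split /=.
    by apply: eq_bigr => i _; rewrite scalerDl.
  - exists (fun i => a * r i); rewrite scaler_sumr.
    by apply: eq_bigr => i _; rewrite scalerA.
move=> x /= xs; exists (fun i => (i == index x s)%:R).
have ltx : (index x s < size s)%N by rewrite index_mem.
rewrite (bigD1 (Ordinal ltx)) //= eqxx scale1r nth_index // big1 ?addr0 // => i.
by rewrite -val_eqE /= => /negPf->; rewrite scale0r.
Qed.

(** Multiplication by b acts on generators of B through a matrix over R, and the
    Cayley-Hamilton argument makes its characteristic polynomial vanish at b. *)
Lemma finite_algebra_integral (b : B) : fg_module B ->
  exists2 p : {poly R}, p \is monic & (map_poly (GRing.in_alg B) p).[b] = 0.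
Proof.
move=> [s sT]; pose k := size s.
have /choice[r rP] (i : 'I_k) : exists r : nat -> R,
    b * s`_i = \sum_(j < k) r j *: s`_j.
  by apply: span_seqP; rewrite sT.
pose M := \matrix_(i < k, j < k) r i j.
exists (char_poly M); first exact: char_poly_monic.
pose D := map_mx (horner_eval b) (char_poly_mx (map_mx (GRing.in_alg B) M)).
have -> : (map_poly (GRing.in_alg B) (char_poly M)).[b] = \det D.
  by rewrite map_char_poly det_map_mx.
have De : D *m (\col_(i < k) s`_i) = 0.
  apply/matrixP => i l; rewrite !mxE.
  have -> : \sum_j D i j * (\col_i s`_i) j l =
      \sum_(j < k) ((i == j)%:R * b * s`_j - r i j *: s`_j).
    apply: eq_bigr => j _; rewrite !mxE /horner_eval hornerD hornerN hornerC.
    rewrite hornerMn hornerX mulrBl [in RHS]mulr_natl; congr (_ - _).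
    by rewrite mulr_algl.
  rewrite sumrB -rP (bigD1 i) //= eqxx mul1r big1 ?addr0 ?subrr // => j.
  by rewrite eq_sym => /negPf->; rewrite !mul0r.
have killed (i : 'I_k) : \det D * s`_i = 0.
  have : \adj D *m (D *m (\col_(i < k) s`_i)) = 0 by rewrite De mulmx0.
  rewrite mulmxA mul_adj_mx mul_scalar_mx => /matrixP/(_ i 0).
  by rewrite !mxE.
have: span [set` s] (1 : B) by rewrite sT.
by move=> /span_seqP[t t1]; rewrite -[LHS]mulr1 t1 mulr_sumr big1 // => i _;
   rewrite -scalerAr killed scaler0.
Qed.

(** Let b be outside P and consider a monic equation of b over R. Its
    coefficients in m vanish modulo P, and powers of b can be cancelled modulo P,
    which leaves a relation r + u b in P where r is the lowest coefficient outside
    m. As r is a unit, b is invertible modulo P. *)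
Lemma prime_over_maximal_is_maximal (m : set R) (P : set B) :
  noetherian R -> local_ring m -> fg_module B -> prime_ideal P ->
  (forall a, m a -> P a%:A) -> maximal_ideal P.
Proof.
move=> noeth localm fgB primeP mP; have [[idm m1 _] _] := localm.
have [idP P1 PM] := primeP; split=> // J idJ J1 PJ; apply/seteqP; split=> // b Jb.
apply: contrapT => nPb.
have step (p : {poly R}) : (exists i, ~ m p`_i) ->
    P (map_poly (GRing.in_alg B) p).[b] ->
    exists2 r, ~ m r & exists u, P (r%:A + u * b).
  elim/poly_ind: p => [[i]|p c IH].
    by rewrite coef0; case; apply: subm0 idm.
  rewrite rmorphD rmorphM /= map_polyX map_polyC hornerMXaddC /=.
  move=> [i nmi] Pcb; have [mc|nmc] := pselect (m c); last first.
    by exists c => //; exists (map_poly (GRing.in_alg B) p).[b]; rewrite addrC.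
  apply: IH.
    case: i nmi => [|i]; rewrite coefD coefMX coefC /= ?add0r // addr0 => nmi.
    by exists i.
  have /PM[//|//] : P ((map_poly (GRing.in_alg B) p).[b] * b).
  by rewrite -[_ * b](addrK c%:A); apply: (submB idP Pcb); apply: mP.
have [p pmon pb] := finite_algebra_integral b fgB.
have [||r nmr [u Pru]] := step p.
- by exists (size p).-1; rewrite -/(lead_coef p) (eqP pmon).
- by rewrite pb; apply: subm0 idP.
apply: nmr; apply: local_nonunit => // y ry; apply: J1.
have Jr : J r%:A.
  rewrite -[r%:A](addrK (u * b)); apply: (submB idJ); first exact: PJ.
  exact: (submZ u idJ).
have -> : 1 = y%:A * r%:A :> B by rewrite mulr_algl scalerA mulrC ry scale1r.
exact: (submZ _ idJ).
Qed.

(** With the next two lemmas, this turns statements on the R-module B into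
    statements on the ring B. *)
Lemma adj_alg (N : set B) a : adj N a = adj (M := B^o) N a%:A.
Proof.
by apply/seteqP; split=> _ [u Nu [w ->]]; exists u => //; exists w;
   rewrite /GRing.scale /= mulr_algl.
Qed.

Lemma gen_alg (N : set B) s :
  gen N s = gen (M := B^o) N (map (GRing.in_alg B) s).
Proof. by elim: s N => //= a s IH N; rewrite IH adj_alg. Qed.

Lemma regular_alg (N : set B) s :
  regular_mod N s <-> regular_mod (M := B^o) N (map (GRing.in_alg B) s).
Proof.
elim: s N => //= a s IH N; rewrite IH adj_alg; split=> -[na rs]; split=> // v.
  by rewrite [X in N X]mulr_algl; apply: na.
by move=> Nv; apply: na; rewrite [X in N X]mulr_algl.
Qed.

End FiniteAlgebras.

(** * Depth of a finite algebra B with m B contained in R *)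

Section ConductorContainsMaximalIdeal.
Variables (R : comNzRingType) (B : comAlgType R) (m : set R) (d : nat).
Hypotheses (noethR : noetherian R) (localm : local_ring m)
  (fgB : fg_module B) (noethB : noetherian B)
  (inj : forall a b : R, a%:A = b%:A :> B -> a = b)
  (mB : forall (a : R) (b : B), m a -> exists c : R, a *: b = c%:A)
  (depthB : forall n : set B, maximal_ideal n -> exists m' : set (localization_at n),
     [/\ noetherian (localization_at n), local_ring m' &
       has_depth m' (localization_at n)^o d]).

Let I : set B := [set x | exists2 a, m a & x = a%:A].

(** For a in m the product a b is the image of some c in R, and c belongs to m:
    otherwise it is a unit, and a has an inverse b' in B. Then b' = a b'^2 lies in
    m B, hence in R, and a would be invertible in R. *)
Lemma extension_is_ideal : is_ideal I.
Proof.
have [[idm m1 _] _] := localm; split=> [|x y [a ma ->] [b mb ->]|b x [a ma ->]].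
- by exists 0; [exact: subm0 idm|rewrite scale0r].
- by exists (a + b); [exact: (submD idm)|rewrite scalerDl].
have [c abE] := mB b ma; exists c; last by rewrite /GRing.scale /= mulr_algr.
apply: local_nonunit => // y cy.
have ayb : a *: (y *: b) = 1.
  by rewrite scalerA mulrC -scalerA abE scalerA mulrC cy scale1r.
have [e eE] := mB (y *: b * (y *: b)) ma.
have eyb : e%:A = y *: b by rewrite -eE scalerAl ayb mul1r.
apply: m1; have <- : e * a = 1; last exact: (submZ e idm).
by apply: inj; rewrite scale1r mulrC -scalerA eyb.
Qed.

(** If no element of I prolongs s, then I lies in an associated prime P of B/(s),
    which is maximal because it contains m; localizing at P shows that s has
    length at least d. *)
Lemma exists_regular_sequence i : (i <= d)%N -> exists s : seq R,
  [/\ size s = i, forall a, a \in s -> m a &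
    regular_mod (M := B^o) [set 0] (map (GRing.in_alg B) s)].
Proof.
elim: i => [_|i IH ltid]; first by exists [::].
have [s [szs sm rs]] := IH (ltnW ltid).
have id0 := @submodule0 B B^o.
have idg := gen_submodule (map (GRing.in_alg B) s) id0.
have [|N P|_ [a ma ->] aP] := exists_nzd (M := B^o) noethB noethB
    (Ns := [:: gen [set 0] (map (GRing.in_alg B) s)]) extension_is_ideal.
- by move=> N; rewrite mem_seq1 => /eqP->.
- rewrite mem_seq1 => /eqP-> [primeP [c _ PE]] IP.
  have maxP : maximal_ideal P.
    apply: (prime_over_maximal_is_maximal noethR localm) => // a ma.
    by apply: IP; exists a.
  have [m' [noethA localm' depthm']] := depthB maxP.
  have := local_depth_le_regular_size maxP noethA localm' depthm' _ rs PE.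
  rewrite size_map szs leqNgt ltid => H; suff: false by [].
  by apply: H => _ /mapP[a /sm ma ->]; apply: IP; exists a.
exists (rcons s a); split; first by rewrite size_rcons szs.
  by move=> b; rewrite mem_rcons inE => /orP[/eqP->|/sm].
rewrite map_rcons; apply/regular_mod_rcons; split=> //.
by apply: aP; rewrite mem_head.
Qed.

Lemma finite_algebra_depth : has_depth m B d.
Proof.
have id0 := @submodule0 B B^o; have [[idm m1 _] _] := localm.
split=> [|s [sm /regular_sequenceE[/regular_alg rs]]].
  have [s [szs sm rs]] := exists_regular_sequence (leqnn d).
  exists s => //; split=> //; apply/regular_sequenceE; split; first exact/regular_alg.
  rewrite gen_alg => gT.
  have : I 1.
    have : gen (M := B^o) [set 0] (map (GRing.in_alg B) s) 1 by rewrite gT.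
    apply: (gen_sub extension_is_ideal) => [_ ->|x w /mapP[a /sm ma ->]].
      exact: (subm0 extension_is_ideal).
    rewrite /GRing.scale /= mulrC; apply: (submZ _ extension_is_ideal).
    by exists a.
  by move=> [a ma e]; apply: m1; rewrite (inj (_ : 1%:A = a%:A)) // scale1r.
rewrite gen_alg => gT; have idg := gen_submodule (map (GRing.in_alg B) s) id0.
have [|n maxn gn] := exists_maximal noethB idg.
  move=> g1; apply: gT; apply/seteqP; split=> // x _.
  by rewrite -[x]mulr1; apply: (submZ x idg).
have [m' [noethA localm' depthm']] := depthB maxn.
rewrite -(size_map (GRing.in_alg B)).
apply: regular_size_le_local_depth maxn _ _ noethA localm' depthm' _ _ rs.
move=> x xs; apply: gn; have := gen_scale 1 id0 xs.
by rewrite /GRing.scale /= mulr1.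
Qed.

End ConductorContainsMaximalIdeal.

(** * Extending homomorphisms to injective modules *)

Section SubmoduleType.
Variables (R : comPzRingType) (M : lmodType R) (N : set M) (hN : is_submodule N).

Definition submodule_pred of is_submodule N : {pred M} := [pred x | `[< N x >]].

Lemma submodule_pred_closed : submod_closed (submodule_pred hN).
Proof.
split=> [|a x y /asboolP Nx /asboolP Ny]; apply/asboolP; first exact: subm0.
by apply: submD => //; apply: submZ.
Qed.

HB.instance Definition _ :=
  GRing.isSubmodClosed.Build R M (submodule_pred hN) submodule_pred_closed.

Definition submodule_type := {x : M | x \in submodule_pred hN}.

HB.instance Definition _ := [isSub of submodule_type for sval].
HB.instance Definition _ := [Choice of submodule_type by <:].
HB.instance Definition _ := [SubChoice_isSubLmodule of submodule_type by <:].

Lemma submodule_typeP (u : submodule_type) : N (val u).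
Proof. by apply/asboolP/(valP u). Qed.

Lemma submodule_typeS x : N x -> exists u : submodule_type, val u = x.
Proof. by move=> /asboolP Nx; exists (exist _ x Nx). Qed.

End SubmoduleType.

Section InjectiveModules.
Variables (R : comPzRingType) (E : lmodType R).
Hypothesis injE : injective_module E.

(** Injectivity for partial homomorphisms: G is the graph of a homomorphism from
    a submodule of M to E, and its first projection is the injective map along
    which the second projection extends. *)
Lemma injective_extends (M : lmodType R) (G : set (M * E)%type) :
  is_submodule G -> (forall y, G (0, y) -> y = 0) ->
  exists h : {linear M -> E}, forall x y, G (x, y) -> h x = y.
Proof.
move=> hG funG; pose L := submodule_type hG.
have lin1 : linear (fun u : L => (val u).1) by move=> a u v; rewrite linearP.
have lin2 : linear (fun u : L => (val u).2) by move=> a u v; rewrite linearP.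
pose f1 := GRing.isLinear.Build _ _ _ _ (fun u : L => (val u).1) lin1.
pose f2 := GRing.isLinear.Build _ _ _ _ (fun u : L => (val u).2) lin2.
pose f : {linear L -> M} := HB.pack (fun u : L => (val u).1) f1.
pose g : {linear L -> E} := HB.pack (fun u : L => (val u).2) f2.
have [u v uv|h hfg] := injE (f := f) g.
  apply: val_inj; have := submodule_typeP (u - v); rewrite raddfB /=.
  have -> : val u - val v = (0, (val u).2 - (val v).2).
    by rewrite -(subrr (val u).1) {2}[(val u).1]uv.
  by move=> /funG/subr0_eq e; apply: injective_projections.
by exists h => x y /(submodule_typeS hG)[u uE]; have := hfg u; rewrite /= uE.
Qed.
End InjectiveModules.

(** * Powers of an ideal and a weak Artin-Rees lemma *)

Section IdealPowers.
Variables (R : comPzRingType) (m : set R).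
Implicit Types I K Q : set R.

Lemma idealM I a b : is_ideal I -> I b -> I (a * b).
Proof. by move=> idI; apply: (submZ a idI). Qed.

Lemma ideal_pow_ideal k : is_ideal (ideal_pow m k).
Proof. by case: k => [|k] //=; apply: span_submodule. Qed.

Lemma ideal_powS_mul k a b : m a -> ideal_pow m k b -> ideal_pow m k.+1 (a * b).
Proof. by move=> ma mb; apply: sub_span; exists a => //; exists b. Qed.

Lemma ideal_powS_sub k I : is_ideal I ->
  (forall a b, m a -> ideal_pow m k b -> I (a * b)) -> ideal_pow m k.+1 `<=` I.
Proof.
move=> idI mI; apply: (@span_sub _ R^o _ I) => //.
by move=> _ [a ma [b mb <-]]; apply: mI.
Qed.

Lemma ideal_pow_le j k : (j <= k)%N -> ideal_pow m k `<=` ideal_pow m j.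
Proof.
move=> /subnK <-; elim: (k - j)%N => [|i IH]; first by rewrite add0n.
rewrite addSn; apply: ideal_powS_sub; first exact: ideal_pow_ideal.
by move=> a b _ /IH mb; apply: idealM => //; apply: ideal_pow_ideal.
Qed.

Lemma ideal_pow_exp a k : m a -> ideal_pow m k (a ^+ k).
Proof.
by move=> ma; elim: k => [|k IH] //; rewrite exprS; apply: ideal_powS_mul.
Qed.

Lemma ideal_pow_add I j k : is_ideal I ->
  (forall x y, ideal_pow m j x -> ideal_pow m k y -> I (x * y)) ->
  ideal_pow m (j + k) `<=` I.
Proof.
elim: j I => [|j IH] I idI jkI; first by move=> y my; rewrite -[y]mul1r; apply: jkI.
rewrite addSn; apply: ideal_powS_sub => // a b ma mb; rewrite mulrC.
apply: (IH (colon (M := R^o) I a)) => //; first exact: (@colon_ideal R R^o).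
move=> x y mx my; rewrite /colon /= /GRing.scale /= mulrC mulrA.
by apply: jkI => //; apply: ideal_powS_mul.
Qed.

Hypothesis noeth : noetherian R.

(** Let P be maximal among the ideals over Q that contain no power of m. If some a
    in m is not in P, then P + a R contains a power of m, and so does (P : a),
    which contains some a^j outside P. Their product lies in P, a
    contradiction. So P contains m itself, which is absurd. *)
Lemma ideal_pow_sub_radical Q : is_ideal Q ->
  (forall a, m a -> exists k, Q (a ^+ k)) -> exists k, ideal_pow m k `<=` Q.
Proof.
move=> idQ radQ; apply: contrapT => noQ.
have [||P [idP QP noP] maxP] := @noetherian_maximal _ R^o
    [set P | [/\ is_ideal P, Q `<=` P & ~ exists k, ideal_pow m k `<=` P]] Q noeth.
- by move=> P [].
- by split.
have grow P' : is_ideal P' -> P `<=` P' -> ~ P' `<=` P ->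
    exists k, ideal_pow m k `<=` P'.
  move=> idP' PP' nP'P; apply: contrapT => noP'; apply: nP'P.
  by apply: (maxP P') (PP'); split=> //; apply: subset_trans PP'.
apply: (noP); exists 1%N; apply: ideal_powS_sub => // a b ma _.
rewrite mulrC; apply: idealM => //; apply: contrapT => nPa.
have [k Pak] : exists k, P (a ^+ k) by have [k /QP] := radQ a ma; exists k.
have [j [nPaj Paj1]] : exists j, ~ P (a ^+ j) /\ P (a ^+ j.+1).
  apply: contrapT => noj; suff : ~ P (a ^+ k) by [].
  elim: (k) => [P1|i IH Pai]; last by apply: noj; exists i.
  by apply: nPa; rewrite -[a]mulr1; apply: idealM => //; rewrite -(expr0 a).
have idadj := @adj_submodule _ R^o P a idP.
have idcol := @colon_ideal _ R^o P a idP.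
have [|||k1 k1P] := grow (adj (M := R^o) P a) => //; first exact: (@sub_adj _ R^o).
  apply: contra_not nPa; apply; have := @adj_scale _ R^o P a 1 idP.
  by rewrite /GRing.scale /= mulr1.
have [|||k2 k2P] := grow (colon (M := R^o) P a) => //.
- by move=> x Px; rewrite /colon /= /GRing.scale /= mulrC; apply: idealM.
- by apply: contra_not nPaj; apply; rewrite /colon /= /GRing.scale /= -exprSr.
apply: noP; exists (k1 + k2)%N; apply: ideal_pow_add => // x y.
move=> /k1P[u Pu [w ->]] /k2P; rewrite /colon /= /GRing.scale /= => Pya.
rewrite mulrDl; apply: (submD idP); first by rewrite mulrC; apply: idealM.
by rewrite [a * w]mulrC -mulrA; apply: idealM => //; rewrite mulrC.
Qed.

(** Take Q maximal among the ideals over K with Q and I meeting inside K. For a in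
    m the increasing sequence (Q : a^n) becomes stationary, at n say. If
    y = u + a^n w lies in I with u in Q, then a^k y lies in K, so w is in
    (Q : a^(k+n)) = (Q : a^n), and y is in Q. Maximality of Q gives a^n in Q, and
    [ideal_pow_sub_radical] concludes. *)
Lemma weak_artin_rees I K k : is_ideal I -> is_ideal K ->
  (forall a b, ideal_pow m k a -> I b -> K (a * b)) ->
  exists2 Q, is_ideal Q /\ (exists j, ideal_pow m j `<=` Q) & Q `&` I `<=` K.
Proof.
move=> idI idK kIK.
have [||Q [idQ KQ QIK] maxQ] := @noetherian_maximal _ R^o
    [set Q | [/\ is_ideal Q, K `<=` Q & Q `&` I `<=` K]] K noeth.
- by move=> Q [].
- by split=> // x [].
exists Q => //; split=> //; apply: ideal_pow_sub_radical => // a ma.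
have [||_ [n _ <-] maxn] := @noetherian_maximal _ R^o
    (range (fun i => colon (M := R^o) Q (a ^+ i))) (colon (M := R^o) Q 1) noeth.
- by move=> _ [i _ <-]; apply: (@colon_ideal _ R^o).
- by exists 0%N.
exists n; apply: (maxQ (adj (M := R^o) Q (a ^+ n))).
- split; first exact: (@adj_submodule _ R^o).
    by apply: (subset_trans KQ); apply: (@sub_adj _ R^o).
  move=> y [[u Qu [w yE]] Iy]; apply: QIK; split=> //.
  rewrite yE; apply: (submD idQ) => //.
  rewrite /GRing.scale /= mulrC.
  apply: (maxn (colon (M := R^o) Q (a ^+ (k + n)))); first by exists (k + n)%N.
    move=> x; rewrite /colon /= /GRing.scale /= => Qx.
    by rewrite exprD mulrCA; apply: idealM.
  rewrite /colon /= /GRing.scale /= mulrC exprD -mulrA.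
  have -> : a ^+ n * w = y - u by rewrite yE addrC addKr.
  rewrite mulrBr; apply: (submB idQ); last exact: idealM.
  by apply: KQ; apply: kIK => //; apply: ideal_pow_exp.
- exact: (@sub_adj _ R^o).
- have := @adj_scale _ R^o Q (a ^+ n) 1 idQ.
  by rewrite /GRing.scale /= mulr1.
Qed.
End IdealPowers.

(** * Local cohomology of torsion modules *)

Section TorsionSplitting.
Variables (R : comPzRingType) (m : set R).
Hypothesis noeth : noetherian R.

Lemma torsion_submodule (M : lmodType R) : is_submodule (torsion m M).
Proof.
split=> [|x y [j jx] [k ky]|a x [k kx]].
- by exists 0%N => a _; rewrite scaler0.
- exists (maxn j k) => a ma; rewrite scalerDr jx ?ky ?addr0 //.
    by apply: ideal_pow_le ma; apply: leq_maxr.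
  by apply: ideal_pow_le ma; apply: leq_maxl.
- by exists k => b mb; rewrite scalerA mulrC -scalerA kx // scaler0.
Qed.

Lemma torsion_linear (M N : lmodType R) (f : {linear M -> N}) x :
  torsion m M x -> torsion m N (f x).
Proof. by move=> [k kx]; exists k => a ma; rewrite -linearZ /= kx ?linear0. Qed.

(** The empty set is admitted in the family to which Zorn's lemma is applied
    because it is the union of the empty chain. *)
Lemma exists_torsion_complement (M : lmodType R) : exists2 C : set M,
  is_submodule C /\ C `&` torsion m M `<=` [set 0] &
  forall C', is_submodule C' -> C' `&` torsion m M `<=` [set 0] ->
    C `<=` C' -> C' `<=` C.
Proof.
have [F FP totF|C [[subC CT] maxC]] := @Zorn_bigcup M
    [set C | (C !=set0 -> is_submodule C) /\ C `&` torsion m M `<=` [set 0]].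
  split=> [[x0 [X0 FX0 X0x0]]|x [[X FX Xx] Tx]]; last by apply: (FP X FX).2.
  have FS X x : F X -> X x -> is_submodule X by move=> /FP[FX _] Xx; apply: FX; exists x.
  split=> [|x y [X FX Xx] [Y FY Yy]|a x [X FX Xx]].
  - by exists X0 => //; apply: subm0; apply: FS X0x0.
  - have [XY|YX] := totF X Y FX FY.
      by exists Y => //; apply: submD (FS _ _ FY Yy) (XY _ Xx) Yy.
    by exists X => //; apply: submD (FS _ _ FX Xx) Xx (YX _ Yy).
  - by exists X => //; apply: submZ (FS _ _ FX Xx) Xx.
have C0 : C !=set0.
  apply: contrapT => /set0P/negP/negPn/eqP C0; apply: (maxC [set 0]).
    by rewrite C0; split=> // /(_ 0 erefl).
  by split=> [_|x []//]; apply: submodule0.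
exists C; first by split=> //; apply: subC.
move=> C' idC' C'T CC'; apply: contrapT => nC'C.
by apply: (maxC C').
Qed.

Variables (E : lmodType R) (injE : injective_module E).
Local Notation T := (torsion m E).

(** Given x, the elements a of R such that a x is in C + T form an ideal, on which
    the T-component of a x is a homomorphism g to E with values in T. It extends to
    R, as multiplication by some e in T. Then a (x - e) is in C as soon as it is in
    C + T, so C + R (x - e) still meets T trivially, and x - e is in C by
    maximality of C. *)
Lemma torsion_complement_spans (C : set E) : is_submodule C ->
  C `&` T `<=` [set 0] ->
  (forall C', is_submodule C' -> C' `&` T `<=` [set 0] ->
    C `<=` C' -> C' `<=` C) ->
  forall x, exists2 e, T e & C (x - e).
Proof.
move=> subC CT maxC x; have subT := torsion_submodule E.
(* G is the graph of g, and I k is the ideal where the value of g is killed by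
   the k-th power of m; the ideals I k become stationary. *)
pose G (a : R) (g : E) := T g /\ C (a *: x - g).
have G0 : G 0 0 by split; [apply: subm0|rewrite scale0r subrr; apply: subm0].
have GD a b g h : G a g -> G b h -> G (a + b) (g + h).
  move=> [Tg Cg] [Th Ch]; split; first exact: submD.
  by rewrite scalerDl opprD addrACA; apply: submD.
have GZ c a g : G a g -> G (c * a) (c *: g).
  move=> [Tg Cg]; split; first exact: submZ.
  by rewrite -scalerA -scalerBr; apply: submZ.
have GU a g h : G a g -> G a h -> g = h.
  move=> [Tg Cg] [Th Ch]; apply/eqP; rewrite -subr_eq0; apply/eqP/CT.
  split; last exact: submB.
  have -> : g - h = (a *: x - h) - (a *: x - g) by rewrite opprB [RHS]addrC subrKA.
  exact: submB.
pose I k : set R := [set a | exists2 g, G a g & forall u, ideal_pow m k u -> u *: g = 0].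
have idI k : is_ideal (I k).
  split=> [|a b [g Gg kg] [h Gh kh]|c a [g Gg kg]].
  - by exists 0 => // u _; rewrite scaler0.
  - by exists (g + h) => [|u mu]; [apply: GD|rewrite scalerDr kg ?kh ?addr0].
  - exists (c *: g) => [|u mu]; first exact: GZ.
    by rewrite scalerA mulrC -scalerA kg // scaler0.
have [||_ [k _ <-] maxk] := @noetherian_maximal _ R^o (range I) (I 0%N) noeth.
- by move=> _ [k _ <-]; apply: idI.
- by exists 0%N.
have kG a g u : G a g -> ideal_pow m k u -> u *: g = 0.
  move=> Gg mu; have [[j jg] _] := Gg.
  have [|b [h Gh hk]||h Gh hk] := maxk (I (maxn k j)) _ _ a.
  - by exists (maxn k j).
  - exists h => // v mv; apply: hk; apply: ideal_pow_le mv; exact: leq_maxl.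
  - exists g => // v mv; apply: jg; apply: ideal_pow_le mv; exact: leq_maxr.
  - by rewrite (GU _ _ _ Gg Gh) hk.
(* g vanishes on K, hence on Q `&` I k, so extending it by zero on Q is possible;
   this is what forces the value e = h 1 of an extension to be torsion. *)
pose K : set R := [set a | G a 0].
have idK : is_ideal K.
  split=> [//|a b Ka Kb|c a Ka]; rewrite /K /=.
    by rewrite -[0]addr0; apply: GD.
  by rewrite -(scaler0 _ c); apply: GZ.
have [a b ma [g Gg _]|Q [idQ [j mQ]] QIK] :=
  weak_artin_rees (m := m) noeth (idI k) idK (k := k).
  by rewrite /K /= -(kG b g a Gg ma); apply: GZ.
have [||h hG] := @injective_extends _ E injE R^o
    [set ag | exists2 b, Q b & G (ag.1 - b) ag.2].
- split=> [|[a g] [a' g'] /= [b Qb Gg] [b' Qb' Gg']|c [a g] /= [b Qb Gg]].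
  + by exists 0; [exact: subm0 idQ|rewrite /= subr0].
  + by exists (b + b'); [exact: (submD idQ)|rewrite opprD addrACA; apply: GD].
  + by exists (c * b); [exact: idealM|rewrite -[c *: a]/(c * a) -mulrBr; apply: GZ].
- move=> g /= [b Qb]; rewrite sub0r => Gg; apply: (GU (- b)) (Gg) _.
  apply: QIK; split; first exact: (submN idQ).
  by exists g => // u mu; apply: kG Gg mu.
have hE a : h a = a *: h 1.
  by rewrite -linearZ /= /GRing.scale /= mulr1.
have Te : T (h 1).
  exists j => a /mQ Qa; rewrite -hE; apply: hG.
  by exists a => //=; rewrite subrr.
have Ge a g : G a g -> g = a *: h 1.
  move=> Gg; rewrite -hE; apply/esym/hG.
  by exists 0; [exact: subm0 idQ|rewrite /= subr0].
exists (h 1) => //.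
apply: (maxC [set v | exists2 c, C c & exists a, v = c + a *: (x - h 1)]).
- split=> [|v w [c Cc [a ->]] [d Cd [b ->]]|b v [c Cc [a ->]]].
  + by exists 0; [apply: subm0|exists 0; rewrite scale0r addr0].
  + exists (c + d); first exact: submD.
    by exists (a + b); rewrite scalerDl addrACA.
  + exists (b *: c); first exact: submZ.
    by exists (b * a); rewrite scalerDr scalerA.
- move=> v [[c Cc [a vE]] Tv] /=.
  have /Ge e : G a (v + a *: h 1).
    split; first by apply: submD => //; apply: submZ.
    rewrite vE -addrA -scalerDr subrK opprD addrCA subrr addr0.
    exact: submN.
  by apply: (addIr (a *: h 1)); rewrite add0r.
- by move=> c Cc; exists c => //; exists 0; rewrite scale0r addr0.
- by exists 0; [apply: subm0|exists 1; rewrite scale1r add0r].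
Qed.

Lemma torsion_projection : exists p : {linear E -> E},
  (forall x, T (p x)) /\ (forall x, T x -> p x = x).
Proof.
have subT := torsion_submodule E.
have [C [subC CT] maxC] := exists_torsion_complement E.
have spanE := torsion_complement_spans subC CT maxC.
have [||p pG] := @injective_extends _ E injE E [set xg | T xg.2 /\ C (xg.1 - xg.2)].
- split=> [|[x g] [y h] [Tg Cg] [Th Ch]|a [x g] [Tg Cg]] /=.
  + by split; [apply: subm0|rewrite subrr; apply: subm0].
  + by split; [apply: submD|rewrite opprD addrACA; apply: submD].
  + by split; [apply: submZ|rewrite -scalerBr; apply: submZ].
- move=> y [/= Ty]; rewrite sub0r => Cy; apply: CT; split=> //.
  by rewrite -[y]opprK; apply: submN.
exists p; split=> x; first by have [e Te Ce] := spanE x; rewrite (pG x e).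
by move=> Tx; apply: pG; split=> //=; rewrite subrr; apply: subm0.
Qed.

Lemma injective_factor (L M : lmodType R) (f : {linear L -> M})
    (q : {linear L -> E}) : (forall x, f x = 0 -> q x = 0) ->
  exists h : {linear M -> E}, forall x, h (f x) = q x.
Proof.
move=> fq; have [||h hG] := @injective_extends _ E injE M (range (fun x => (f x, q x))).
- split=> [|_ _ [x _ <-] [y _ <-]|a _ [x _ <-]].
  + by exists 0 => //; rewrite !linear0.
  + by exists (x + y) => //; rewrite !linearD.
  + by exists (a *: x) => //; rewrite !linearZ.
- by move=> _ [x _ [/fq + <-]].
by exists h => x; apply: hG; exists x.
Qed.

End TorsionSplitting.

Section TorsionModules.
Variables (R : comPzRingType) (m : set R) (N : lmodType R).
Hypotheses (noeth : noetherian R) (torN : forall v, torsion m N v).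

(** The map h is one component of a contraction of E modulo its torsion
    subcomplex: d - d h d takes values in the images of torsion elements. In
    degree 0 it is obtained from the projection p onto torsion, because id - p
    kills the image of N. In the next degree, (id - p)(id - d h) kills the
    boundaries by the property of h, so it factors through d. A torsion cocycle
    x = d y is then the coboundary of the torsion element h x + g. *)
Theorem torsion_local_cohomology i : local_cohomology_vanishes m N i.+1.
Proof.
move=> E; have split_tor j := torsion_projection m noeth (@res_injective _ _ E j).
have exS j y : res_diff E j.+1 y = 0 -> exists z, res_diff E j z = y.
  move=> dy; have : [set x | res_diff E j.+1 x = 0] y by [].
  by rewrite -res_exactS => -[z _ <-]; exists z.
have dd j z : res_diff E j.+1 (res_diff E j z) = 0.
  have : range (res_diff E j) (res_diff E j z) by exists z.
  by rewrite res_exactS.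
have [h hP] : exists h : {linear res_mod E i.+1 -> res_mod E i},
    forall y, exists2 g, torsion m (res_mod E i) g &
      res_diff E i y - res_diff E i (h (res_diff E i y)) = res_diff E i g.
  elim: i => [|i [h hP]].
    have [p [pT pid]] := split_tor 0%N.
    have [|h hq] := injective_factor (@res_injective _ _ E 0)
        (f := res_diff E 0) (q := idfun \- p : {linear _ -> _}).
      move=> x dx; have : [set x | res_diff E 0 x = 0] x by [].
      rewrite -res_exact0 => -[v _ <-] /=; rewrite pid ?subrr //.
      exact: torsion_linear.
    exists h => y; exists (p y) => //.
    by rewrite hq /= linearB /= opprB addrC subrK.
  have [p [pT pid]] := split_tor i.+1.
  pose c : {linear res_mod E i.+1 -> res_mod E i.+1} := idfun \- (res_diff E i \o h).
  have [|h' hq] := injective_factor (@res_injective _ _ E i.+1)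
      (f := res_diff E i.+1) (q := (idfun \- p) \o c : {linear _ -> _}).
    move=> x /exS[z <-] /=; have [g Tg ->] := hP z.
    by rewrite pid ?subrr //; apply: torsion_linear.
  exists h' => y; exists (p (c y)) => //.
  have dc : res_diff E i.+1 (c y) = res_diff E i.+1 y.
    by rewrite /c /= linearB /= dd subr0.
  by rewrite hq -[X in _ - res_diff E _ X]/(c y - p (c y)) linearB dc subKr.
move=> x [Tx /exS[y yx]]; have [g Tg] := hP y; rewrite yx => /eqP.
rewrite subr_eq addrC => /eqP xE; exists (h x + g); last by rewrite linearD.
by apply: submD; [apply: torsion_submodule|apply: torsion_linear|].
Qed.

End TorsionModules.

(** * The Cohen-Macaulayfication *)

Lemma quotient_dim_unique (R : comPzRingType) (I : set R) d e :
  has_quotient_dim I d -> has_quotient_dim I e -> d = e.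
Proof.
by move=> [dI leI] [eI leI']; apply/eqP; rewrite eqn_leq leI' ?leI.
Qed.

Lemma cm_local_ring_depth (A : comPzRingType) d :
  cm_local_ring A -> has_ring_dim A d ->
  exists m : set A, [/\ noetherian A, local_ring m & has_depth m A^o d].
Proof.
move=> [noeth [m [localm [_ [e [dime depthe]]]]]] dimd; exists m; split=> //.
suff -> : d = e by [].
apply: quotient_dim_unique dimd _.
suff -> : [set 0] = annihilator A^o :> set A by exact: dime.
apply/seteqP; split=> [_ -> v|a /(_ 1)]; first exact: scale0r.
by rewrite /GRing.scale /= mulr1.
Qed.

Lemma to_total_quotient_inj (R : comNzRingType) : injective (@to_total_quotient R).
Proof.
move=> a b /loc_fracE[t ht]; rewrite !mulr1 => e.
have /(_ _ e)/subr0_eq : forall x, t * x = 0 -> x = 0.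
  move: ht => /(_ [set s : R | forall x, s * x = 0 -> x = 0]); apply.
  split=> //; split=> [x|s u sreg ureg x]; first by rewrite mul1r.
  by rewrite -mulrA => /sreg/ureg.
by [].
Qed.

Theorem theorem4 (R : comNzRingType) (m : set R) (B : comAlgType R) :
  noetherian R -> local_ring m -> adically_complete m ->
  is_goto_cm_fication m B ->
  is_cm_fication m (structure_map B : {linear R^o -> B}).
Proof.
move=> noeth localm _ [d [d2 dimR [j [jinj jE]] [cmB fgB dimB] mB]].
have inj (a b : R) : a%:A = b%:A :> B -> a = b.
  by move=> e; apply: to_total_quotient_inj; rewrite -!jE e.
have annB : annihilator B = [set 0].
  apply/seteqP; split=> [a /(_ 1)|_ -> v]; last exact: scale0r.
  by rewrite -[RHS](scale0r (1 : B)) => /inj.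
have annR : annihilator R^o = [set 0].
  apply/seteqP; split=> [a /(_ 1)|_ -> v]; last exact: scale0r.
  by rewrite /GRing.scale /= mulr1.
have dimMB : has_module_dim B d by rewrite /has_module_dim annB.
have depthB : has_depth m B d.
  apply: finite_algebra_depth => //; first by case: cmB.
  by move=> n maxn; apply: cm_local_ring_depth; [case: cmB => _; apply|apply: dimB].
have torsion_coker v : torsion m (coker (structure_map B : {linear R^o -> B})) v.
  (* m B is contained in R, so m itself kills B/R. *)
  exists 1%N; elim/quotW: v => b a ma.
  have {}ma : m a.
    have [[idm _ _] _] := localm.
    by apply: (@ideal_powS_sub _ m 0 m) ma => // x y mx _; rewrite mulrC; apply: idealM.
  have [c abE] := mB a b ma.
  rewrite -[LHS]/(coker_scale a _) !piE abE; apply/eqP.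
  by rewrite -Quotient.idealrBE subr0; apply/asboolP; exists c.
split=> //; [|by split=> //; exists d|].
  exists [:: 1]; apply/seteqP; split=> // x _.
  have s1 : span [set` [:: 1 : R^o]] 1 by apply: sub_span; rewrite /= mem_head.
  by have := submZ x (span_submodule _) s1; rewrite [_ *: _]mulr1.
exists d; split=> //; first by rewrite /has_module_dim annR.
  by move: d2; case: (d) => [|[|k]] // _ _; apply: torsion_local_cohomology.
by move: d2; case: (d) => [|k] // _; apply: torsion_local_cohomology.
Qed.
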